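(* The inflection locus $\mathcal I$ of the system of ionized gas dynamics is an algebraic curve (in the $(\alpha,T)$-plane) having a singularity at $(\alpha,T)=(0,0)$. Near this point there exist two branches of $\mathcal I$, whose behavior for $T\to0$ is, respectively, $$\alpha\sim 60\left(\frac{T}{T_{\rm i}}\right)^{3}\qquad\text{and}\qquad \alpha\sim\left(\frac{T}{T_{\rm i}}\right)^{\frac32}.$$
   Context: Fix positive constants $a^2$, $T_{\rm i}$, $\kappa$. Thermodynamic states of the ionized gas are pairs $(\alpha,T)$ with $0<\alpha<1$ (degree of ionization) and $T>0$ (temperature). The pressure is $p=\frac1\kappa\frac{1-\alpha^2}{\alpha^2}T^{5/2}e^{-T_{\rm i}/T}$ (so $(p,T)$ may be used as coordinates, with $\alpha=(1+\kappa pT^{-5/2}e^{T_{\rm i}/T})^{-1/2}$), the specific volume is $v=a^2(1+\alpha)T/p$, the internal energy is $e=a^2\left[\frac32(1+\alpha)T+T_{\rm i}\alpha\right]$, and the dimensionless entropy (with $a^2T\,d\eta=de+p\,dv$) is, up to a constant, $\eta=-2\log\frac{1-\alpha}{\alpha}+(1+\alpha)\left(\frac52+\frac{T_{\rm i}}{T}\right)$. The system in Lagrangian coordinates, $v_t-u_\xi=0$, $u_t+p_\xi=0$, $(e+\frac12u^2)_t+(pu)_\xi=0$, has eigenvalues $\lambda_\pm=\pm\lambda$ and $0$, with $\lambda>0$ and $$\lambda^2=\frac{p^2\left[\frac52+\frac12\alpha(1-\alpha)\left(\frac52+\frac{T_{\rm i}}{T}\right)^2\right]}{a^2T(1+\alpha)\left[\frac32+\frac12\alpha(1-\alpha)\left(\frac{15}{4}+\frac{3T_{\rm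 i}}{T}+\frac{T_{\rm i}^2}{T^2}\right)\right]}.$$ In the variables $(p,T)$, $R_\pm\nabla=\pm\left(\frac{\partial}{\partial p}-\frac{\eta_p}{\eta_T}\frac{\partial}{\partial T}\right)$ is the derivative along the $\pm$ characteristic field, and $R_+\nabla\lambda_+=R_-\nabla\lambda_-$. The inflection locus is $\mathcal I=\{(\alpha,T):\ R_\pm\nabla\lambda_\pm=0,\ 0<\alpha<1,\ T>0\}$. *)

(* Defs.v *)
From HB Require Import structures.
From mathcomp Require Import all_boot all_order all_algebra.
From mathcomp Require Import all_classical all_reals all_analysis.
Import Order.TTheory GRing.Theory Num.Theory.
Import numFieldNormedType.Exports.

Set Implicit Arguments.
Unset Strict Implicit.
Unset Printing Implicit Defensive.

Local Open Scope classical_set_scope.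
Local Open Scope ring_scope.

(* [a2], [Ti], [kappa] stand for the constants a^2, T_i, kappa. A state
   [z : R * R] is the pair (alpha, T). *)

Definition state_domain (R : realType) : set (R * R) :=
  [set z | 0 < z.1 < 1 /\ 0 < z.2].

Definition pressure (R : realType) (Ti kappa alpha T : R) : R :=
  kappa^-1 * ((1 - alpha ^+ 2) / alpha ^+ 2) * T `^ (5 / 2) * expR (- (Ti / T)).

(* Inverse of [pressure] in its [alpha] argument, at fixed [T]; it makes (p, T)
   coordinates. *)
Definition ionization (R : realType) (Ti kappa p T : R) : R :=
  (1 + kappa * p * T `^ (- (5 / 2)) * expR (Ti / T)) `^ (- (1 / 2)).

Definition entropy_alphaT (R : realType) (Ti alpha T : R) : R :=
  - 2 * ln ((1 - alpha) / alpha) + (1 + alpha) * (5 / 2 + Ti / T).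

Definition lambda2_alphapT (R : realType) (a2 Ti alpha p T : R) : R :=
  p ^+ 2 * (5 / 2 + 1 / 2 * alpha * (1 - alpha) * (5 / 2 + Ti / T) ^+ 2) /
  (a2 * T * (1 + alpha) *
   (3 / 2 + 1 / 2 * alpha * (1 - alpha) *
            (15 / 4 + 3 * Ti / T + Ti ^+ 2 / T ^+ 2))).

Definition entropy (R : realType) (Ti kappa p T : R) : R :=
  entropy_alphaT Ti (ionization Ti kappa p T) T.

(* [s = false] gives the characteristic speed lambda_+ = lambda,
   [s = true] gives lambda_- = - lambda. *)
Definition char_speed (R : realType) (a2 Ti kappa : R) (s : bool) (p T : R) : R :=
  (-1) ^+ s * Num.sqrt (lambda2_alphapT a2 Ti (ionization Ti kappa p T) p T).

Definition partial_p (R : realType) (f : R -> R -> R) (p T : R) : R :=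
  derive1 (fun q => f q T) p.

Definition partial_T (R : realType) (f : R -> R -> R) (p T : R) : R :=
  derive1 (fun t => f p t) T.

(* Derivative of [f] along the characteristic field R_+ ([s = false]) or
   R_- ([s = true]). *)
Definition char_field (R : realType) (Ti kappa : R) (s : bool)
    (f : R -> R -> R) (p T : R) : R :=
  (-1) ^+ s *
  (partial_p f p T -
   partial_p (entropy Ti kappa) p T / partial_T (entropy Ti kappa) p T *
   partial_T f p T).

(* The two conditions, for R_+ and R_-, are the same, since
   R_+ nabla lambda_+ = R_- nabla lambda_-. *)
Definition inflection_locus (R : realType) (a2 Ti kappa : R) : set (R * R) :=
  [set z | state_domain z /\
     forall s : bool,
       char_field Ti kappa s (char_speed a2 Ti kappa s)
         (pressure Ti kappa z.1 z.2) z.2 = 0].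

(* In [F : {poly {poly R}}] the first variable (here alpha) is the outer one,
   the second variable (here T) is the inner one. *)

Definition eval2 (R : realType) (F : {poly {poly R}}) (z : R * R) : R :=
  F.[z.1%:P].[z.2].

Definition pderiv1 (R : realType) (F : {poly {poly R}}) : {poly {poly R}} :=
  deriv F.

Definition pderiv2 (R : realType) (F : {poly {poly R}}) : {poly {poly R}} :=
  map_poly (@deriv R) F.

Definition algebraic_curve_in (R : realType) (U S : set (R * R)) : Prop :=
  exists F : {poly {poly R}},
    (forall c : R, F != c%:P%:P) /\ S = U `&` [set z | eval2 F z = 0].

(* The ideal of the curve, i.e. of the Zariski closure of [S]. *)
Definition vanishing_ideal (R : realType) (S : set (R * R)) :
    set {poly {poly R}} :=
  [set G | forall z, S z -> eval2 G z = 0].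

(* Jacobian criterion for a plane curve [S] and a point [z], which need not be
   in [S] itself: [z] is on the Zariski closure of [S], and at [z] the Jacobian
   matrix of the ideal of [S] has rank < 1, the codimension. Using the whole
   ideal, rather than one equation of the curve, rules out singularities due to
   a non-reduced equation or to spurious factors. *)
Definition singular_point (R : realType) (S : set (R * R)) (z : R * R) : Prop :=
  forall G, vanishing_ideal S G ->
    [/\ eval2 G z = 0, eval2 (pderiv1 G) z = 0 & eval2 (pderiv2 G) z = 0].

(* Main.v *)
Require Import Defs.
From HB Require Import structures.
From mathcomp Require Import all_boot all_order all_algebra.
From mathcomp Require Import all_classical all_reals all_analysis.
From mathcomp Require Import ring lra.
Import Order.TTheory GRing.Theory Num.Theory.
Import numFieldNormedType.Exports.

Local Open Scope classical_set_scope.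
Local Open Scope ring_scope.

(** The proof rests on an explicit equation of the inflection locus.

    Write a for the degree of ionization, x = Ti / T and w = a (1 - a) / 2. The
    Saha relation gives the partial derivatives of a with respect to p and T,
    hence those of the entropy and of lambda^2. Up to a positive factor, the
    derivative of the characteristic speed along its own field is a polynomial
    in a and x ([inflection_poly], [char_field_speed]):
      P = (4 + w (2 x^2 + 8 x + 10)) B C + 2 w x^2 A^2
          - (1 - 2 a) (1 + a) w x^3 / 2,
    where A, B, C are affine in w. So the locus is P = 0, and T^6 P is a
    polynomial in a and T: the locus is an algebraic curve.

    For a < 1/2 only the last term of P is negative, which leads to two balances as T
    tends to 0. With w of order x^-3 the equation reads 15 = a x^3 / 4, that
    is, a = 60 x^-3. With w of order x^(-3/2) the leading terms are
    2 (w x^2)^3 and w x^3 / 2, whose equality gives a = x^(-3/2). In the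
    variable d = x^(-1/2), P on the curves a = k d^6 and d^3 P on the curves
    a = k d^3 are polynomials in d, and their values at d = 0 give the sign of
    P on these curves for small T.

    That there are no other zeros near a = 0 comes from convexity: for x >= 8
    the function P / w is strictly convex in a on (0, 1/12)
    ([inflection_quot_convex]), and it takes the signs +, -, + at explicit points.
    So it has exactly two zeros, and it is negative precisely between them
    ([strictly_convex_two_zeros], [branches_exist]). This sign rule turns the
    signs of P on the model curves into the two asymptotic equivalences, and
    the continuity of P in T into the continuity of the zeros.

    Finally, a polynomial vanishing on both branches has no linear part at the
    origin: the branch a ~ 60 x^-3 is tangent to the T-axis, which kills the
    T-derivative, and the branch a ~ x^(-3/2) dominates T^2, which kills the
    a-derivative ([singular_point_of_branches]). *)

(** * Ionization as a function of pressure and temperature *)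

Section Ionization.
Context {R : realType} {Ti kappa : R}.
Hypothesis hkappa : 0 < kappa.
Implicit Types (p T alpha : R).

(** By Saha's law this is the ratio (1 - alpha^2) / alpha^2; see [saha]. *)
Definition saha_ratio p T := kappa * p * T `^ (- (5 / 2)) * expR (Ti / T).

Lemma saha_ratio_gt0 p T : 0 < p -> 0 < T -> 0 < saha_ratio p T.
Proof. by move=> p0 T0; rewrite !mulr_gt0 ?powR_gt0 ?expR_gt0. Qed.

Lemma ionization_invsqrt p T : 0 < p -> 0 < T ->
  ionization Ti kappa p T = (Num.sqrt (1 + saha_ratio p T))^-1.
Proof.
move=> p0 T0; have /ltW u0 := saha_ratio_gt0 p T p0 T0.
by rewrite /ionization powRN div1r powR12_sqrt// addr_ge0.
Qed.

Lemma ionization_itv p T : 0 < p -> 0 < T -> 0 < ionization Ti kappa p T < 1.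
Proof.
move=> p0 T0; have u0 := saha_ratio_gt0 p T p0 T0.
rewrite ionization_invsqrt// invr_gt0 sqrtr_gt0 addr_gt0//=.
rewrite invf_lt1 ?sqrtr_gt0 ?addr_gt0//.
by rewrite -[ltLHS]sqrtr1 ltr_sqrt ?addr_gt0// ltrDl.
Qed.

Lemma saha p T : 0 < p -> 0 < T ->
  saha_ratio p T =
  (1 - ionization Ti kappa p T ^+ 2) / ionization Ti kappa p T ^+ 2.
Proof.
move=> p0 T0; have u0 := saha_ratio_gt0 p T p0 T0.
rewrite ionization_invsqrt// exprVn sqr_sqrtr ?addr_ge0 ?ltW//.
by field; rewrite gt_eqF// addr_gt0.
Qed.

Lemma pressure_gt0 alpha T : 0 < alpha < 1 -> 0 < T ->
  0 < pressure Ti kappa alpha T.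
Proof.
move=> /andP[a0 a1] T0.
rewrite /pressure !mulr_gt0 ?invr_gt0 ?powR_gt0 ?expR_gt0 ?exprn_gt0//.
by rewrite subr_gt0 expr_lt1// ltW.
Qed.

Lemma ionization_pressure alpha T : 0 < alpha < 1 -> 0 < T ->
  ionization Ti kappa (pressure Ti kappa alpha T) T = alpha.
Proof.
move=> a01 T0; have p0 := pressure_gt0 alpha T a01 T0.
have /andP[a0 a1] := a01.
rewrite ionization_invsqrt// -[RHS]invrK; congr _^-1.
rewrite -[RHS]gtr0_norm ?invr_gt0// -sqrtr_sqr; congr Num.sqrt.
rewrite /saha_ratio /pressure powRN expRN.
have eT : T `^ (5 / 2) != 0 by rewrite gt_eqF// powR_gt0.
have eE : expR (Ti / T) != 0 by rewrite gt_eqF// expR_gt0.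
by field; rewrite eT eE !gt_eqF.
Qed.

(** The derivatives are taken along a curve [t |-> (pr t, te t)], so that one
    computation serves for both partial derivatives: one of the two components
    is then the identity and the other one is constant. *)
Lemma is_derive_saha_ratio (pr te : R -> R) t dp dT :
    0 < pr t -> 0 < te t -> is_derive t 1 pr dp -> is_derive t 1 te dT ->
  is_derive t 1 (fun s => saha_ratio (pr s) (te s))
    (saha_ratio (pr t) (te t) *
     (dp / pr t - (5 / 2 + Ti / te t) * (dT / te t))).
Proof.
move=> p0 T0 Dp DT.
have tN : te t != 0 by rewrite gt_eqF.
have pN : pr t != 0 by rewrite gt_eqF.
have Dq : is_derive t 1 (fun s => te s `^ (- (5 / 2)))
    (- (5 / 2) * te t `^ (- (5 / 2)) / te t * dT).
  apply: (is_derive_eq (is_derive1_comp (is_derive1_powR (- (5 / 2)) T0) DT)).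
  by rewrite powRB ?(gt_eqF T0) ?implybT// powRr1 ?ltW// mulrA.
have Dx : is_derive t 1 (fun s => Ti / te s) (- (Ti / te t / te t) * dT).
  by apply: is_derive_eq; rewrite /GRing.scale /=; field.
have De : is_derive t 1 (fun s => expR (Ti / te s))
    (expR (Ti / te t) * (- (Ti / te t / te t) * dT)).
  exact: (is_derive1_comp (is_derive_expR _) Dx).
rewrite /saha_ratio; apply: is_derive_eq; rewrite /GRing.scale /=.
by field; rewrite tN pN.
Qed.

(** Since alpha = (1 + S)^(-1/2) with S the Saha ratio, d alpha is
    - alpha^3 / 2 * S * d (ln S), and alpha^2 * S = 1 - alpha^2 by [saha]. *)
Lemma is_derive_ionization (pr te : R -> R) t dp dT :
    0 < pr t -> 0 < te t -> is_derive t 1 pr dp -> is_derive t 1 te dT ->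
  is_derive t 1 (fun s => ionization Ti kappa (pr s) (te s))
    (let a := ionization Ti kappa (pr t) (te t) in
     a * (1 - a ^+ 2) / 2 *
     (- (dp / pr t) + (5 / 2 + Ti / te t) * (dT / te t))).
Proof.
move=> p0 T0 Dp DT; set a := ionization _ _ _ _.
have w0 : 0 < 1 + saha_ratio (pr t) (te t) by rewrite addr_gt0// saha_ratio_gt0.
have /andP[a0 _] := ionization_itv _ _ p0 T0; rewrite -/a in a0.
have Du := is_derive_saha_ratio pr te t dp dT p0 T0 Dp DT.
have Du1 : is_derive t 1 (fun s => 1 + saha_ratio (pr s) (te s))
    (0 + saha_ratio (pr t) (te t) *
         (dp / pr t - (5 / 2 + Ti / te t) * (dT / te t))).
  exact: is_deriveD.
have Di := is_derive1_comp (g := fun s => 1 + saha_ratio (pr s) (te s))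
  (is_derive1_powR (- (1 / 2)) w0) Du1.
apply: (is_derive_eq (f := fun s => ionization Ti kappa (pr s) (te s)) Di).
rewrite /= powRB ?(gt_eqF w0) ?implybT// powRr1 ?(ltW w0)//.
rewrite -[_ `^ (- (1 / 2))]/a (saha _ _ p0 T0) -/a.
have tN : te t != 0 by rewrite gt_eqF.
have pN : pr t != 0 by rewrite gt_eqF.
have aN : a != 0 by rewrite gt_eqF.
by field; rewrite tN aN pN /= addrCA subrr addr0 oner_eq0.
Qed.

End Ionization.

(** * The derivative of the characteristic speed along its field *)

Section Inflection.
Context {R : realType}.
Implicit Types (a x : R).

(** Throughout, [a] is the degree of ionization and [x = Ti / T]. The four
    functions below are the building blocks of the thermodynamics: with
    w, A, B, C for them, p * eta_p = - (1 + a) * A, T * eta_T = (1 + a) * B and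
    lambda^2 = p^2 * B / (a2 * T * (1 + a) * C). *)
Definition half_var a := a * (1 - a) / 2.
Definition weightA a x := 1 + half_var a * (5 / 2 + x).
Definition weightB a x := 5 / 2 + half_var a * (5 / 2 + x) ^+ 2.
Definition weightC a x := 3 / 2 + half_var a * (15 / 4 + 3 * x + x ^+ 2).

(** Along the field p * R_+ one has p' = p, T' = T * A / B,
    a' = w * (1 + a) * x / B and x' = - x * A / B, because
    (5/2 + x) * A - B = x. Multiplying the derivative of ln lambda^2 by
    B^2 * C gives
      (2 * B - A - w * x) * B * C + C * (B * B') - B * (B * C').
    In C * (B * B') - B * (B * C') the coefficient of B * w' is
    (5/2 + x)^2 * C - (15/4 + 3 * x + x^2) * B = - x^2, where w cancels, and the
    one of - w * B * x' is (3 + 2 * x) * B - 2 * (5/2 + x) * C = 2 * x * A; this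
    is how the expression below arises. *)
Definition inflection_poly a x :=
  (4 + half_var a * (2 * x ^+ 2 + 8 * x + 10)) * weightB a x * weightC a x
  + 2 * half_var a * x ^+ 2 * weightA a x ^+ 2
  - (1 - 2 * a) * (1 + a) * half_var a * x ^+ 3 / 2.

Lemma half_var_gt0 a : 0 < a < 1 -> 0 < half_var a.
Proof. by move=> /andP[a0 a1]; rewrite /half_var !mulr_gt0 ?subr_gt0. Qed.

Lemma weightB_gt0 a x : 0 < a < 1 -> 0 < weightB a x.
Proof.
by move=> /half_var_gt0 w0; rewrite /weightB ltr_wpDr // mulr_ge0 ?sqr_ge0// ltW.
Qed.

Lemma weightC_gt0 a x : 0 < a < 1 -> 0 < x -> 0 < weightC a x.
Proof.
move=> /half_var_gt0 w0 x0; rewrite /weightC addr_gt0// mulr_gt0//.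
by rewrite !addr_gt0 ?mulr_gt0.
Qed.

Context {a2 Ti kappa : R}.
Hypotheses (ha2 : 0 < a2) (hTi : 0 < Ti) (hkappa : 0 < kappa).

Lemma is_derive_entropy (al te : R -> R) t da dT : 0 < al t < 1 -> 0 < te t ->
    is_derive t 1 al da -> is_derive t 1 te dT ->
  is_derive t 1 (fun s => entropy_alphaT Ti (al s) (te s))
    (da * (2 / (al t * (1 - al t)) + (5 / 2 + Ti / te t))
     - (1 + al t) * (Ti / te t ^+ 2) * dT).
Proof.
move=> /andP[a0 a1] T0 Da DT.
have aN : al t != 0 by rewrite gt_eqF.
have bN : 1 - al t != 0 by rewrite gt_eqF// subr_gt0.
have tN : te t != 0 by rewrite gt_eqF.
have r0 : 0 < (1 - al t) / al t by rewrite divr_gt0// subr_gt0.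
have Dr : is_derive t 1 (fun s => (1 - al s) / al s) (- (da / al t ^+ 2)).
  by apply: is_derive_eq; rewrite /GRing.scale /=; field.
have Dl : is_derive t 1 (fun s => ln ((1 - al s) / al s))
    (- (da / (al t * (1 - al t)))).
  apply: (is_derive_eq (is_derive1_comp (g := fun s => (1 - al s) / al s)
    (is_derive1_ln r0) Dr)).
  by field; rewrite aN bN.
rewrite /entropy_alphaT; apply: is_derive_eq; rewrite /GRing.scale /=.
by field; rewrite aN bN tN.
Qed.

Lemma is_derive_lambda2 (al pr te : R -> R) t da dp dT :
    0 < al t < 1 -> 0 < te t ->
    is_derive t 1 al da -> is_derive t 1 pr dp -> is_derive t 1 te dT ->
  is_derive t 1 (fun s => lambda2_alphapT a2 Ti (al s) (pr s) (te s))
    (let a := al t in let T := te t in let p := pr t in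
     let x := Ti / T in
     let B := weightB a x in let C := weightC a x in
     let dw := (1 - 2 * a) / 2 * da in
     let dx := - (x / T) * dT in
     let dB := dw * (5 / 2 + x) ^+ 2 + half_var a * (2 * (5 / 2 + x)) * dx in
     let dC := dw * (15 / 4 + 3 * x + x ^+ 2)
       + half_var a * (3 + 2 * x) * dx in
     p / (a2 * T * (1 + a) * C) *
     (2 * dp * B + p * dB - p * B * (dT / T + da / (1 + a) + dC / C))).
Proof.
move=> a01 T0 Da Dp DT; cbv zeta; have /andP[a0 a1] := a01.
have tN : te t != 0 by rewrite gt_eqF.
have cN : a2 != 0 by rewrite gt_eqF.
have aN : 1 + al t != 0 by rewrite gt_eqF// addr_gt0.
have CN : weightC (al t) (Ti / te t) != 0.
  by rewrite gt_eqF// weightC_gt0// divr_gt0.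
have CE : 3 / 2 + 1 / 2 * al t * (1 - al t) *
   (15 / 4 + 3 * Ti / te t + Ti ^+ 2 / te t ^+ 2) = weightC (al t) (Ti / te t).
  by rewrite /weightC /half_var; field.
have D1 : is_derive t 1
   (fun s => pr s ^+ 2 *
     (5 / 2 + 1 / 2 * al s * (1 - al s) * (5 / 2 + Ti / te s) ^+ 2))
   (pr t * (2 * dp * weightB (al t) (Ti / te t) +
     pr t * ((1 - 2 * al t) / 2 * da * (5 / 2 + Ti / te t) ^+ 2
      + half_var (al t) * (2 * (5 / 2 + Ti / te t)) *
        - (Ti / te t / te t) * dT))).
  apply: is_derive_eq; rewrite /GRing.scale /=.
  by rewrite /weightB /half_var; field.
have t2N : te t ^+ 2 != 0 by rewrite expf_neq0.
have Dv : is_derive t 1 (fun s => (te s ^+ 2)^-1) (- 2 / te t ^+ 3 * dT).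
  by apply: is_derive_eq; rewrite /GRing.scale /=; field.
have D2 : is_derive t 1 (fun s => 3 / 2 + 1 / 2 * al s * (1 - al s) *
   (15 / 4 + 3 * Ti / te s + Ti ^+ 2 / te s ^+ 2))
   ((1 - 2 * al t) / 2 * da * (15 / 4 + 3 * (Ti / te t) + (Ti / te t) ^+ 2)
      + half_var (al t) * (3 + 2 * (Ti / te t)) * - (Ti / te t / te t) * dT).
  apply: is_derive_eq; rewrite /GRing.scale /=.
  by rewrite /half_var; field.
rewrite /lambda2_alphapT.
have NZ : a2 * te t * (1 + al t) * (3 / 2 + 1 / 2 * al t * (1 - al t) *
   (15 / 4 + 3 * Ti / te t + Ti ^+ 2 / te t ^+ 2)) != 0.
  by rewrite CE !mulf_neq0.
apply: is_derive_eq; rewrite /GRing.scale /= CE.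
have -> : 5 / 2 + 1 / 2 * al t * (1 - al t) * (5 / 2 + Ti / te t) ^+ 2 =
  weightB (al t) (Ti / te t) by rewrite /weightB /half_var; field.
move: (weightC _ _) (weightB _ _) (half_var _) CN => C B w CN.
by field; rewrite cN tN aN CN.
Qed.

Lemma lambda2E a p T : T != 0 -> lambda2_alphapT a2 Ti a p T =
  p ^+ 2 * weightB a (Ti / T) / (a2 * T * (1 + a) * weightC a (Ti / T)).
Proof.
move=> tN; rewrite /lambda2_alphapT /weightB /weightC /half_var.
by congr (_ * (_ + _) / (_ * (_ + _))); field.
Qed.

Lemma lambda2_gt0 a p T : 0 < a < 1 -> 0 < p -> 0 < T ->
  0 < lambda2_alphapT a2 Ti a p T.
Proof.
move=> a01 p0 T0; have /andP[a0 a1] := a01.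
have B0 := weightB_gt0 a (Ti / T) a01.
have C0 : 0 < weightC a (Ti / T) by rewrite weightC_gt0// divr_gt0.
by rewrite lambda2E ?gt_eqF// divr_gt0// !mulr_gt0// addr_gt0.
Qed.

(** The speed is the square root of lambda^2, so its derivative is
    lambda / 2 times the derivative of ln lambda^2. The sign of the field and
    the sign of the speed cancel, which is why the right-hand side does not
    depend on [s]; every factor besides [inflection_poly] is positive. *)
Lemma char_field_speed s p T : 0 < p -> 0 < T ->
  char_field Ti kappa s (char_speed a2 Ti kappa s) p T =
  let a := ionization Ti kappa p T in let x := Ti / T in
  char_speed a2 Ti kappa false p T * inflection_poly a x /
  (2 * p * weightB a x ^+ 2 * weightC a x).
Proof.
move=> p0 T0; cbv zeta.
have Dap := is_derive_ionization (Ti := Ti) hkappa (fun q => q) (fun=> T)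
  p _ _ p0 T0 (is_derive_id p 1) (is_derive_cst T p 1).
have DaT := is_derive_ionization (Ti := Ti) hkappa (fun=> p) (fun t => t)
  T _ _ p0 T0 (is_derive_cst p T 1) (is_derive_id T 1).
cbv zeta beta in Dap, DaT.
have a01 := ionization_itv (Ti := Ti) hkappa p T p0 T0.
have Dep := is_derive_entropy (fun q => ionization Ti kappa q T) (fun=> T)
  p _ _ a01 T0 Dap (is_derive_cst T p 1).
have DeT := is_derive_entropy (fun t => ionization Ti kappa p t) (fun t => t)
  T _ _ a01 T0 DaT (is_derive_id T 1).
have Dlp := is_derive_lambda2 (fun q => ionization Ti kappa q T) (fun q => q)
  (fun=> T) p _ _ _ a01 T0 Dap (is_derive_id p 1) (is_derive_cst T p 1).
have DlT := is_derive_lambda2 (fun t => ionization Ti kappa p t) (fun=> p)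
  (fun t => t) T _ _ _ a01 T0 DaT (is_derive_cst p T 1) (is_derive_id T 1).
have L0 := lambda2_gt0 _ _ _ a01 p0 T0.
have Dsp := is_derive1_comp (g := fun q =>
  lambda2_alphapT a2 Ti (ionization Ti kappa q T) q T) (is_derive1_sqrt L0) Dlp.
have DsT := is_derive1_comp (g := fun t =>
  lambda2_alphapT a2 Ti (ionization Ti kappa p t) p t) (is_derive1_sqrt L0) DlT.
have val (f : R -> R) (t d : R) : is_derive t 1 f d -> derive1 f t = d.
  by move=> [_ <-]; rewrite derive1E.
rewrite /char_field /partial_p /partial_T.
have valZ (f : R -> R) (t c d : R) :
    is_derive t 1 f d -> derive1 (fun q => c * f q) t = c * d.
  by move=> Df; apply: val; exact: is_deriveZ.
rewrite (val _ _ _ Dep) (val _ _ _ DeT) (valZ _ _ _ _ Dsp) (valZ _ _ _ _ DsT).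
cbv beta zeta; rewrite /char_speed expr0 [1 * Num.sqrt _]mul1r.
have LE := lambda2E (ionization Ti kappa p T) p T (lt0r_neq0 T0).
move: (lambda2_alphapT _ _ _ _ _) L0 LE => L L0 LE.
have Sq : Num.sqrt L ^+ 2 = L by rewrite sqr_sqrtr ?ltW.
have SN : Num.sqrt L != 0 by rewrite gt_eqF// sqrtr_gt0.
have TN : T != 0 by rewrite gt_eqF.
have -> : Ti / T ^+ 2 = Ti / T / T by field.
have x0 : 0 < Ti / T by rewrite divr_gt0.
move: (ionization _ _ _ _) (Ti / T) x0 a01 LE => a x x0 a01 LE.
have /andP[a0 a1] := a01.
have pN : p != 0 by rewrite gt_eqF.
have cN : a2 != 0 by rewrite gt_eqF.
have aN : a != 0 by rewrite gt_eqF.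
have a1N : 1 - a != 0 by rewrite gt_eqF// subr_gt0.
have a2N : 1 + a != 0 by rewrite gt_eqF// addr_gt0.
have BN : weightB a x != 0 by rewrite gt_eqF// weightB_gt0.
have CN : weightC a x != 0 by rewrite gt_eqF// weightC_gt0.
(* the two partial derivatives of the entropy *)
have -> : a * (1 - a ^+ 2) / 2 * (- (1 / p) + (5 / 2 + x) * (0 / T)) *
    (2 / (a * (1 - a)) + (5 / 2 + x)) - (1 + a) * (x / T) * 0 =
    - ((1 + a) * weightA a x / p).
  by rewrite /weightA /half_var; field; rewrite pN TN aN a1N.
have -> : a * (1 - a ^+ 2) / 2 * (- (0 / p) + (5 / 2 + x) * (1 / T)) *
    (2 / (a * (1 - a)) + (5 / 2 + x)) - (1 + a) * (x / T) * 1 =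
    (1 + a) * weightB a x / T.
  by rewrite /weightB /half_var; field; rewrite pN TN aN a1N.
have -> : p / (a2 * T * (1 + a) * weightC a x) =
    Num.sqrt L ^+ 2 / (p * weightB a x).
  by rewrite Sq LE; field; rewrite pN cN TN a2N BN CN.
(* [e] is the sign (-1) ^+ s, present in the field and in the speed *)
have comb (e X r Y : R) : e * e = 1 -> e * (e * X - r * (e * Y)) = X - r * Y.
  by move=> e2; rewrite -[RHS]mul1r -e2; ring.
rewrite comb; last by rewrite -expr2 sqrr_sign.
have wE : a * (1 - a ^+ 2) / 2 = half_var a * (1 + a).
  by rewrite /half_var; field.
rewrite wE.
(* B times the derivatives along the field p * R_+ of a, B and C, with A, B, C
   kept as atoms: the derivative formula is then an identity without relations
   between the atoms, and those enter only in the next identity *)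
pose Da := half_var a * (1 + a) * ((5 / 2 + x) * weightA a x - weightB a x).
pose DB := (1 - 2 * a) / 2 * Da * (5 / 2 + x) ^+ 2
  - half_var a * (2 * (5 / 2 + x)) * x * weightA a x.
pose DC := (1 - 2 * a) / 2 * Da * (15 / 4 + 3 * x + x ^+ 2)
  - half_var a * (3 + 2 * x) * x * weightA a x.
have -> : inflection_poly a x =
    (2 * weightB a x - weightA a x - Da / (1 + a)) * weightB a x * weightC a x
    + weightC a x * DB - weightB a x * DC.
  rewrite /DB /DC /Da /inflection_poly /weightA /weightB /weightC /half_var.
  by field.
rewrite /DB /DC /Da; clear DB DC Da wE LE Sq L0 x0.
move: (weightA _ _) (weightB _ _) (weightC _ _) (half_var _) (Num.sqrt L) BN CN SN
  => A B C w S BN CN SN.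
by field; rewrite pN TN BN CN a2N SN.
Qed.

End Inflection.

(** * The inflection locus as an algebraic curve *)

Section Curve.
Context {R : realType}.

Lemma inflection_locusE (a2 Ti kappa : R) (z : R * R) :
    0 < a2 -> 0 < Ti -> 0 < kappa ->
  inflection_locus a2 Ti kappa z <->
  state_domain z /\ inflection_poly z.1 (Ti / z.2) = 0.
Proof.
move=> ha2 hTi hkappa; rewrite /inflection_locus /=.
suff P0 s : state_domain z -> char_field Ti kappa s (char_speed a2 Ti kappa s)
    (pressure Ti kappa z.1 z.2) z.2 = 0 <-> inflection_poly z.1 (Ti / z.2) = 0.
  by split=> -[zD z0]; split=> //; [apply/(P0 false) | move=> s; apply/P0].
move=> [a01 T0]; have p0 := pressure_gt0 (Ti := Ti) hkappa _ _ a01 T0.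
rewrite char_field_speed//; cbv zeta; rewrite (ionization_pressure hkappa)//.
have S0 : 0 < char_speed a2 Ti kappa false (pressure Ti kappa z.1 z.2) z.2.
  rewrite /char_speed expr0 mul1r sqrtr_gt0.
  by apply: lambda2_gt0 => //; exact: ionization_itv.
have B0 := weightB_gt0 z.1 (Ti / z.2) a01.
have C0 : 0 < weightC z.1 (Ti / z.2) by rewrite weightC_gt0// divr_gt0.
move: (char_speed _ _ _ _ _ _) (weightB _ _) (weightC _ _) S0 B0 C0.
move=> S B C S0 B0 C0.
have D0 : 0 < 2 * pressure Ti kappa z.1 z.2 * B ^+ 2 * C.
  apply: mulr_gt0 C0; apply: mulr_gt0 (exprn_gt0 2 B0).
  exact: mulr_gt0 p0.
split=> [/eqP|->]; last by rewrite mulr0 mul0r.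
by rewrite mulf_eq0 mulf_eq0 (gt_eqF S0) invr_eq0 (gt_eqF D0) orbF => /eqP.
Qed.

(** [T^6 * inflection_poly a (Ti / T)] with the powers of T cleared: [t * y]
    and [t^2 * c] are the homogenizations of 5/2 + x and
    15/4 + 3 * x + x^2. *)
Definition inflection_equation (Ti : R) : {poly {poly R}} :=
  let cst (c : R) : {poly {poly R}} := c%:P%:P in
  let a : {poly {poly R}} := 'X in
  let t : {poly {poly R}} := 'X%:P in
  let w := cst (1 / 2) * a * (1 - a) in
  let y := cst (5 / 2) * t + cst Ti in
  let c := cst (15 / 4) * t ^+ 2 + cst (3 * Ti) * t + cst (Ti ^+ 2) in
  (cst 4 * t ^+ 2 +
   w * (cst (2 * Ti ^+ 2) + cst (8 * Ti) * t + cst 10 * t ^+ 2)) *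
  (cst (5 / 2) * t ^+ 2 + w * y ^+ 2) * (cst (3 / 2) * t ^+ 2 + w * c)
  + cst (2 * Ti ^+ 2) * w * t ^+ 2 * (t + w * y) ^+ 2
  - (1 - cst 2 * a) * (1 + a) * w * cst (Ti ^+ 3 / 2) * t ^+ 3.

Lemma eval2_inflection_equation (Ti a T : R) : T != 0 ->
  eval2 (inflection_equation Ti) (a, T) = T ^+ 6 * inflection_poly a (Ti / T).
Proof.
move=> TN; rewrite /eval2 /inflection_equation /= !hornerE /=.
rewrite /inflection_poly /weightA /weightB /weightC /half_var.
by field.
Qed.

Lemma inflection_equation_nonconstant (Ti : R) (c : R) :
  inflection_equation Ti != c%:P%:P.
Proof.
apply/eqP => E.
(* a constant would take the same value at (0, 0) and at (0, 1) *)
have e0 : eval2 (inflection_equation Ti) (0, 0) = 0.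
  by rewrite /eval2 /inflection_equation /= !hornerE /=; ring.
have e1 : eval2 (inflection_equation Ti) (0, 1) = 15.
  by rewrite /eval2 /inflection_equation /= !hornerE /=; field.
move: e0 e1; rewrite E /eval2 /= !hornerE => -> /esym/eqP.
by rewrite pnatr_eq0.
Qed.

Lemma inflection_locus_algebraic (a2 Ti kappa : R) :
    0 < a2 -> 0 < Ti -> 0 < kappa ->
  algebraic_curve_in (@state_domain R) (inflection_locus a2 Ti kappa).
Proof.
move=> ha2 hTi hkappa; exists (inflection_equation Ti); split.
  exact: inflection_equation_nonconstant.
apply/seteqP; split=> -[a T] /=; rewrite inflection_locusE//=.
  move=> [zD P0]; split=> //; rewrite eval2_inflection_equation ?P0 ?mulr0//.
  by case: zD => _ T0; rewrite gt_eqF.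
move=> [zD E0]; split=> //; move: E0.
have TN : T != 0 by case: zD => _ T0; rewrite gt_eqF.
rewrite eval2_inflection_equation// => /eqP.
by rewrite mulf_eq0 expf_eq0 (negbTE TN) andbF => /eqP.
Qed.

End Curve.

(** * Zeros of convex functions *)

Section TwoZeros.
Context {R : realType}.
Implicit Types (f : R -> R).

Definition strictly_convex_on (l r : R) f := forall u v s,
  l < u -> u < v -> v < s -> s < r ->
  f v * (s - u) < f u * (s - v) + f s * (v - u).

(** Besides the zeros themselves the lemma delivers the sign of [f]: this is
    what later turns sign computations at explicit points into estimates for
    the zeros, and into their continuity with respect to a parameter. *)
Lemma strictly_convex_two_zeros (l r a m b : R) f :
    l < a -> a < m -> m < b -> b < r ->
    {within `[a, b], continuous f} -> strictly_convex_on l r f ->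
    0 < f a -> f m < 0 -> 0 < f b ->
  exists r1 r2 : R,
    [/\ a < r1, r1 < m, m < r2, r2 < b & forall v, l < v < r ->
      (f v = 0 <-> v = r1 \/ v = r2) /\ (f v < 0 <-> r1 < v < r2)].
Proof.
move=> la am mb br fc fcv fa fm fb.
have [r1 r1I f1] : exists2 c, c \in `[a, m] & f c = 0.
  apply: IVT; first exact: ltW.
    apply: continuous_subspaceW fc; apply: subset_itvl.
    by rewrite bnd_simp ltW.
  by rewrite ge_min le_max (ltW fa) (ltW fm) orbT.
have [r2 r2I f2] : exists2 c, c \in `[m, b] & f c = 0.
  apply: IVT; first exact: ltW.
    apply: continuous_subspaceW fc; apply: subset_itvr.
    by rewrite bnd_simp ltW.
  by rewrite ge_min le_max (ltW fb) (ltW fm) orbT.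
have neq u v : f u < 0 \/ 0 < f u -> f v = 0 -> u != v.
  by move=> fu fv; apply/eqP => uv; move: fu; rewrite uv fv ltxx => -[].
move: r1I r2I; rewrite !in_itv/= => /andP[ar1 r1m] /andP[mr2 r2b].
have {}ar1 : a < r1 by rewrite lt_neqAle ar1 neq//; right.
have {}r1m : r1 < m by rewrite lt_neqAle r1m eq_sym neq//; left.
have {}mr2 : m < r2 by rewrite lt_neqAle mr2 neq//; left.
have {}r2b : r2 < b by rewrite lt_neqAle r2b eq_sym neq//; right.
exists r1, r2; split=> // v /andP[lv vr].
have r12 : r1 < r2 := lt_trans r1m mr2.
have inside : r1 < v < r2 -> f v < 0.
  move=> /andP[v1 v2].
  have := fcv r1 v r2 (lt_trans la ar1) v1 v2 (lt_trans r2b br).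
  by rewrite f1 f2 !mul0r addr0 pmulr_llt0// subr_gt0.
have left : v < r1 -> 0 < f v.
  move=> v1; have := fcv v r1 r2 lv v1 r12 (lt_trans r2b br).
  by rewrite f1 f2 !mul0r addr0 pmulr_lgt0// subr_gt0.
have right : r2 < v -> 0 < f v.
  move=> v2; have := fcv r1 r2 v (lt_trans la ar1) r12 v2 vr.
  by rewrite f1 f2 !mul0r add0r pmulr_lgt0// subr_gt0.
case: (ltgtP v r1) => [v1|v1|->].
- have fv := left v1; split; split.
  + by move=> f0; rewrite f0 ltxx in fv.
  + by case=> E; move: (lt_trans v1 r12); rewrite E ?ltxx// in v1 *.
  + by move=> /(lt_trans fv); rewrite ltxx.
  + by [].
- case: (ltgtP v r2) => [v2|v2|->].
  + have fv := inside (introT andP (conj v1 v2)); split; split=> //.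
    * by move=> f0; rewrite f0 ltxx in fv.
    * by case=> E; rewrite E ltxx in v1 v2.
  + have fv := right v2; split; split=> //.
    * by move=> f0; rewrite f0 ltxx in fv.
    * by case=> E; move: v1 v2; rewrite E ?ltxx// => _ /lt_trans/(_ r12);
        rewrite ltxx.
    * by move=> /(lt_trans fv); rewrite ltxx.
  + rewrite f2 !ltxx; split; split=> //; by right.
- rewrite f1 !ltxx; split; split=> //; by left.
Qed.

End TwoZeros.

(** * Convexity of the inflection polynomial in the degree of ionization *)

Section Convexity.
Context {R : realType}.
Implicit Types (a x : R).

Definition quot_coef1 x := (2 * x ^+ 2 + 8 * x + 10) * (15 / 4)
  + 4 * (3 / 2 * (5 / 2 + x) ^+ 2 + 5 / 2 * (15 / 4 + 3 * x + x ^+ 2))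
  + 2 * x ^+ 2.
Definition quot_coef2 x := 4 * (5 / 2 + x) ^+ 2 * (15 / 4 + 3 * x + x ^+ 2)
  + (2 * x ^+ 2 + 8 * x + 10) *
    (3 / 2 * (5 / 2 + x) ^+ 2 + 5 / 2 * (15 / 4 + 3 * x + x ^+ 2))
  + 4 * x ^+ 2 * (5 / 2 + x).
Definition quot_coef3 x := (2 * x ^+ 2 + 8 * x + 10) * (5 / 2 + x) ^+ 2 *
    (15 / 4 + 3 * x + x ^+ 2) + 2 * x ^+ 2 * (5 / 2 + x) ^+ 2.

(** The inflection polynomial is a cubic in w = [half_var a], with constant
    term 15, minus (1 - 2 * a) * (1 + a) * w * x^3 / 2. Dividing by w > 0 keeps
    its sign and makes it convex in [a]. *)
Definition inflection_quot x a :=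
  15 / half_var a + quot_coef1 x + quot_coef2 x * half_var a
  + quot_coef3 x * half_var a ^+ 2 - (1 - 2 * a) * (1 + a) * x ^+ 3 / 2.

Lemma inflection_polyE x a : half_var a != 0 ->
  inflection_poly a x = half_var a * inflection_quot x a.
Proof.
rewrite /inflection_poly /inflection_quot /weightA /weightB /weightC => wN.
by rewrite /quot_coef1 /quot_coef2 /quot_coef3; field.
Qed.

(** [quot_coef3] has degree 6 in [x] and [quot_coef2] degree 4, so any constant
    would do for large [x]; the proof of convexity calls for 4. *)
Lemma quot_coef2_le_coef3 x : 8 <= x -> 4 * quot_coef2 x <= quot_coef3 x.
Proof.
move=> x8; rewrite /quot_coef2 /quot_coef3.
have xx : 8 * 8 <= x ^+ 2 by rewrite expr2 ler_pM.
have y8 : 8 <= 5 / 2 + x by lra.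
have yy : 8 * 8 <= (5 / 2 + x) ^+ 2 by rewrite expr2 ler_pM.
have [g c] : 64 <= 2 * x ^+ 2 + 8 * x + 10 /\ 24 <= 15 / 4 + 3 * x + x ^+ 2.
  by split; lra.
move: (x ^+ 2) (5 / 2 + x) (15 / 4 + 3 * x + x ^+ 2) (2 * x ^+ 2 + 8 * x + 10)
  xx y8 yy g c => X y C G xx y8 yy g c.
rewrite -subr_ge0 (_ : _ - _ = y ^+ 2 * C * (G / 4 - 16)
  + G * y ^+ 2 * (C / 4 - 6) + G * C * (y ^+ 2 / 4 - 10)
  + G * y ^+ 2 * C / 4 + 2 * X * y * (y - 8)); last by field.
by rewrite !addr_ge0// !mulr_ge0//; lra.
Qed.

(** The second-order divided differences of the terms of [inflection_quot] are
    nonnegative, except for the one of w, which is - 1/2. It is compensated by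
    the term in w^2, whose divided difference is at least 1/8 for points in
    (0, 1/12), since [quot_coef3] is at least 4 times [quot_coef2]. *)
Lemma inflection_quot_convex x : 8 <= x ->
  strictly_convex_on 0 (1 / 12) (inflection_quot x).
Proof.
move=> x8 u v s u0 uv vs s12.
have q3 := quot_coef2_le_coef3 x x8.
have x0 : 0 <= x by apply: le_trans x8.
have q2 : 0 <= quot_coef2 x.
  by rewrite /quot_coef2 !(addr_ge0, mulr_ge0, exprn_ge0, invr_ge0).
have v0 : 0 < v by exact: lt_trans uv.
have s0 : 0 < s by exact: lt_trans vs.
rewrite -subr_gt0.
have -> : inflection_quot x u * (s - v) + inflection_quot x s * (v - u)
    - inflection_quot x v * (s - u) =
  (s - v) * (v - u) * (s - u) *
  (30 / (u * v * s) + 30 / ((1 - u) * (1 - v) * (1 - s))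
   + quot_coef3 x / 4 * (1 - 2 * (u + v + s)
        + (u ^+ 2 + v ^+ 2 + s ^+ 2 + u * v + v * s + u * s))
   - quot_coef2 x / 2 + x ^+ 3).
  rewrite /inflection_quot /half_var; field.
  by rewrite !gt_eqF//; lra.
rewrite mulr_gt0 ?mulr_gt0 ?subr_gt0 ?(lt_trans uv vs)//.
have spread : 1 / 2 <= 1 - 2 * (u + v + s)
    + (u ^+ 2 + v ^+ 2 + s ^+ 2 + u * v + v * s + u * s).
  have : 0 <= u ^+ 2 + v ^+ 2 + s ^+ 2 + u * v + v * s + u * s.
    by rewrite !addr_ge0 ?exprn_ge0 ?mulr_ge0// ltW.
  lra.
have k1 : 0 < 30 / (u * v * s) by rewrite divr_gt0// !mulr_gt0.
have k2 : 0 < 30 / ((1 - u) * (1 - v) * (1 - s)).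
  by rewrite divr_gt0// !mulr_gt0// subr_gt0; lra.
have k3 : 0 <= x ^+ 3 by rewrite exprn_ge0.
have : quot_coef3 x / 4 * (1 / 2) <= quot_coef3 x / 4 * (1 - 2 * (u + v + s)
    + (u ^+ 2 + v ^+ 2 + s ^+ 2 + u * v + v * s + u * s)).
  by apply: ler_wpM2l => //; lra.
lra.
Qed.

End Convexity.

(** * The two branches near the origin *)

Section Scaling.
Context {R : realType}.
Implicit Types (a k d : R).

(** In the variable d = (T / Ti)^(1/2), so that x = d^-2, both regimes become
    polynomial. On the curves a = k * d^6 the inflection polynomial itself
    extends to d = 0, with value (60 - k) / 4; on the curves a = k * d^3 this
    holds after multiplication by d^3, with value k * (k^2 - 1) / 4. The sign
    changes at k = 60 and at k = 1 are the two branches. *)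
Definition lower_scaled k d :=
  let a := k * d ^+ 6 in let u := d ^+ 2 * (k * (1 - a) / 2) in
  (4 + u * (2 + 8 * d ^+ 2 + 10 * d ^+ 4)) *
  (5 / 2 + u * (1 + 5 / 2 * d ^+ 2) ^+ 2) *
  (3 / 2 + u * (1 + 3 * d ^+ 2 + 15 / 4 * d ^+ 4))
  + 2 * u * (1 + u * d ^+ 2 * (1 + 5 / 2 * d ^+ 2)) ^+ 2
  - (1 - 2 * a) * (1 + a) * (k * (1 - a)) / 4.

Definition upper_scaled k d :=
  let a := k * d ^+ 3 in let v := k * (1 - a) / 2 in
  (4 * d + v * (2 + 8 * d ^+ 2 + 10 * d ^+ 4)) *
  (5 / 2 * d + v * (1 + 5 / 2 * d ^+ 2) ^+ 2) *
  (3 / 2 * d + v * (1 + 3 * d ^+ 2 + 15 / 4 * d ^+ 4))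
  + 2 * v * d ^+ 2 * (1 + v * d * (1 + 5 / 2 * d ^+ 2)) ^+ 2
  - (1 - 2 * a) * (1 + a) * v / 2.

Lemma lower_scaledE k d : d != 0 ->
  inflection_poly (k * d ^+ 6) (d ^+ 2)^-1 = lower_scaled k d.
Proof.
move=> dN; rewrite /inflection_poly /weightA /weightB /weightC /half_var.
by rewrite /lower_scaled; field.
Qed.

Lemma upper_scaledE k d : d != 0 ->
  d ^+ 3 * inflection_poly (k * d ^+ 3) (d ^+ 2)^-1 = upper_scaled k d.
Proof.
move=> dN; rewrite /inflection_poly /weightA /weightB /weightC /half_var.
by rewrite /upper_scaled; field.
Qed.

Lemma lower_scaled0 k : lower_scaled k 0 = (60 - k) / 4.
Proof. by rewrite /lower_scaled; field. Qed.

Lemma upper_scaled0 k : upper_scaled k 0 = k * (k - 1) * (k + 1) / 4.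
Proof. by rewrite /upper_scaled; field. Qed.

Lemma is_derive_continuous (f : R -> R) (t df : R) :
  is_derive t 1 f df -> {for t, continuous f}.
Proof. by move=> [Df _]; exact/differentiable_continuous/derivable1_diffP. Qed.

Lemma continuous_lower_scaled k : {for 0, continuous (lower_scaled k)}.
Proof. by rewrite /lower_scaled; apply: is_derive_continuous. Qed.

Lemma continuous_upper_scaled k : {for 0, continuous (upper_scaled k)}.
Proof. by rewrite /upper_scaled; apply: is_derive_continuous. Qed.

End Scaling.

Section Branches.
Context {R : realType} {Ti : R}.
Hypothesis hTi : 0 < Ti.
Implicit Types (T k : R).

Definition sqrt_temp T := Num.sqrt (T / Ti).

Lemma sqrt_temp_gt0 T : 0 < T -> 0 < sqrt_temp T.
Proof. by move=> T0; rewrite sqrtr_gt0 divr_gt0. Qed.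

Lemma sqrt_temp_sqr T : 0 < T -> sqrt_temp T ^+ 2 = T / Ti.
Proof. by move=> T0; rewrite sqr_sqrtr// ltW// divr_gt0. Qed.

Lemma sqrt_temp_sqrV T : 0 < T -> Ti / T = (sqrt_temp T ^+ 2)^-1.
Proof. by move=> T0; rewrite sqrt_temp_sqr// invf_div. Qed.

Lemma cvg_sqrt_temp : sqrt_temp T @[T --> 0^'+] --> 0.
Proof.
suff : sqrt_temp T @[T --> 0^'+] --> Num.sqrt (0 / Ti) by rewrite mul0r sqrtr0.
apply: (continuous_cvg _ (@sqrt_continuous R (0 / Ti))).
apply: cvgM; last exact: cvg_cst.
exact: (cvg_at_right_filter cvg_id).
Qed.

Lemma scaled_lt (f : R -> R) c : {for 0, continuous f} -> f 0 < c ->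
  \forall T \near 0^'+, f (sqrt_temp T) < c.
Proof.
move=> fc f0; have : f (sqrt_temp T) @[T --> 0^'+] --> f 0.
  exact: (continuous_cvg _ fc cvg_sqrt_temp).
by move=> /cvgr_lt; apply.
Qed.

Lemma scaled_gt (f : R -> R) c : {for 0, continuous f} -> c < f 0 ->
  \forall T \near 0^'+, c < f (sqrt_temp T).
Proof.
move=> fc f0; have : f (sqrt_temp T) @[T --> 0^'+] --> f 0.
  exact: (continuous_cvg _ fc cvg_sqrt_temp).
by move=> /cvgr_gt; apply.
Qed.

Lemma lower_sign_lt0 k : 60 < k ->
  \forall T \near 0^'+, inflection_poly (k * sqrt_temp T ^+ 6) (Ti / T) < 0.
Proof.
move=> k60; near=> T; have T0 : 0 < T by near: T; exact: nbhs_right_gt.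
rewrite sqrt_temp_sqrV// lower_scaledE ?gt_eqF ?sqrt_temp_gt0//.
near: T; apply: scaled_lt; first exact: continuous_lower_scaled.
by rewrite lower_scaled0; lra.
Unshelve. all: by end_near. Qed.

Lemma lower_sign_gt0 k : k < 60 ->
  \forall T \near 0^'+, 0 < inflection_poly (k * sqrt_temp T ^+ 6) (Ti / T).
Proof.
move=> k60; near=> T; have T0 : 0 < T by near: T; exact: nbhs_right_gt.
rewrite sqrt_temp_sqrV// lower_scaledE ?gt_eqF ?sqrt_temp_gt0//.
near: T; apply: scaled_gt; first exact: continuous_lower_scaled.
by rewrite lower_scaled0; lra.
Unshelve. all: by end_near. Qed.

Lemma upper_sign_lt0 k : 0 < k < 1 ->
  \forall T \near 0^'+, inflection_poly (k * sqrt_temp T ^+ 3) (Ti / T) < 0.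
Proof.
move=> /andP[k0 k1]; near=> T.
have T0 : 0 < T by near: T; exact: nbhs_right_gt.
have d0 := sqrt_temp_gt0 T T0.
rewrite sqrt_temp_sqrV// -(pmulr_rlt0 _ (exprn_gt0 3 d0)) upper_scaledE ?gt_eqF//.
near: T; apply: scaled_lt; first exact: continuous_upper_scaled.
rewrite upper_scaled0 pmulr_llt0// pmulr_llt0 ?addr_gt0//.
by rewrite pmulr_rlt0// subr_lt0.
Unshelve. all: by end_near. Qed.

Lemma upper_sign_gt0 k : 1 < k ->
  \forall T \near 0^'+, 0 < inflection_poly (k * sqrt_temp T ^+ 3) (Ti / T).
Proof.
move=> k1; have k0 : 0 < k by exact: lt_trans k1.
near=> T; have T0 : 0 < T by near: T; exact: nbhs_right_gt.
have d0 := sqrt_temp_gt0 T T0.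
rewrite sqrt_temp_sqrV// -(pmulr_rgt0 _ (exprn_gt0 3 d0)) upper_scaledE ?gt_eqF//.
near: T; apply: scaled_gt; first exact: continuous_upper_scaled.
rewrite upper_scaled0; apply: divr_gt0 => //.
by apply: mulr_gt0; [apply: mulr_gt0 => // |]; lra.
Unshelve. all: by end_near. Qed.

(** The condition on the sign is part of the notion: the asymptotics and the
    continuity of the branches are read off from it. *)
Definition branches (delta eps : R) (r1 r2 : R -> R) := forall T, 0 < T < delta ->
  [/\ 0 < r1 T, r1 T < r2 T, r2 T < eps & forall a, 0 < a < eps ->
    (inflection_poly a (Ti / T) = 0 <-> a = r1 T \/ a = r2 T) /\
    (inflection_poly a (Ti / T) < 0 <-> r1 T < a < r2 T)].

Lemma continuous_inflection_quot (x a : R) : 0 < a < 1 ->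
  {for a, continuous (inflection_quot x)}.
Proof.
move=> a01; have w0 : half_var a != 0 by rewrite gt_eqF// half_var_gt0.
rewrite /inflection_quot.
have Dw : is_derive a 1 (@half_var R) ((1 - 2 * a) / 2).
  by rewrite /half_var; apply: is_derive_eq; rewrite /GRing.scale /=; field.
exact: is_derive_continuous.
Qed.

(** On the segment from 30 * d^6 to 2 * d^3 the convex function has the signs
    +, -, + at the left end, at 120 * d^6 and at the right end: 30 and 120 lie
    on either side of 60, and 2 lies above 1. *)
Lemma branches_exist : exists (delta : R) (r1 r2 : R -> R),
  0 < delta /\ branches delta (1 / 12) r1 r2.
Proof.
have [delta /= d0 near0] : \forall T \near 0^'+,
    exists r : R * R, [/\ 0 < r.1, r.1 < r.2, r.2 < 1 / 12 &
      forall a, 0 < a < 1 / 12 ->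
      (inflection_poly a (Ti / T) = 0 <-> a = r.1 \/ a = r.2) /\
      (inflection_poly a (Ti / T) < 0 <-> r.1 < a < r.2)].
  near=> T; have T0 : 0 < T by near: T; exact: nbhs_right_gt.
  have d0 := sqrt_temp_gt0 T T0.
  have x8 : 8 <= Ti / T.
    rewrite ler_pdivlMr// -ler_pdivlMl// mulrC; near: T.
    by apply: nbhs_right_le; rewrite divr_gt0.
  have d1 : sqrt_temp T < 1 / 24.
    by near: T; apply: (scaled_lt id); [exact: cvg_id | exact: divr_gt0].
  have [d3 d36] : 2 * sqrt_temp T ^+ 3 < 1 / 12 /\
      120 * sqrt_temp T ^+ 6 < 2 * sqrt_temp T ^+ 3.
    have e2 : sqrt_temp T ^+ 2 < 1 / 24 * sqrt_temp T by rewrite expr2 ltr_pM2r.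
    have e3 : sqrt_temp T ^+ 3 < 1 / 24 * sqrt_temp T ^+ 2.
      by rewrite exprS ltr_pM2r ?exprn_gt0.
    split; first by lra.
    rewrite (_ : 120 * _ = 120 * sqrt_temp T ^+ 3 * sqrt_temp T ^+ 3).
      2: by ring.
    by rewrite ltr_pM2r ?exprn_gt0//; lra.
  have a1 : 0 < 30 * sqrt_temp T ^+ 6 by rewrite mulr_gt0 ?exprn_gt0.
  have ab : 30 * sqrt_temp T ^+ 6 < 120 * sqrt_temp T ^+ 6.
    by rewrite ltr_pM2r ?exprn_gt0// ltr_nat.
  have quot a : 0 < a < 1 / 12 -> 0 < half_var a /\
      inflection_poly a (Ti / T) = half_var a * inflection_quot (Ti / T) a.
    move=> a12; have w0 : 0 < half_var a by apply: half_var_gt0; lra.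
    by split=> //; rewrite inflection_polyE ?gt_eqF.
  have pos a : 0 < a < 1 / 12 -> 0 < inflection_poly a (Ti / T) ->
      0 < inflection_quot (Ti / T) a.
    by move=> /quot[w0 ->]; rewrite pmulr_rgt0.
  have neg a : 0 < a < 1 / 12 ->
      (inflection_poly a (Ti / T) < 0) = (inflection_quot (Ti / T) a < 0).
    by move=> /quot[w0 ->]; rewrite pmulr_rlt0.
  have cont : {within `[30 * sqrt_temp T ^+ 6, 2 * sqrt_temp T ^+ 3],
      continuous (inflection_quot (Ti / T))}.
    apply: continuous_in_subspaceT => a; rewrite inE/= in_itv/= => /andP[l r].
    by apply: continuous_inflection_quot; lra.
  have qa : 0 < inflection_quot (Ti / T) (30 * sqrt_temp T ^+ 6).
    apply: pos; first lra.
    by near: T; apply: lower_sign_gt0; rewrite ltr_nat.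
  have qm : inflection_quot (Ti / T) (120 * sqrt_temp T ^+ 6) < 0.
    rewrite -neg; last lra.
    by near: T; apply: lower_sign_lt0; rewrite ltr_nat.
  have qb : 0 < inflection_quot (Ti / T) (2 * sqrt_temp T ^+ 3).
    apply: pos; first lra.
    by near: T; apply: upper_sign_gt0; rewrite ltr1n.
  have [r1 [r2 [ar1 r1m mr2 r2b E]]] := strictly_convex_two_zeros _ _ _ _ _ _
    a1 ab d36 d3 cont (inflection_quot_convex _ x8) qa qm qb.
  exists (r1, r2) => /=; split.
  - exact: lt_trans ar1.
  - exact: lt_trans mr2.
  - exact: lt_trans d3.
  move=> a a12; rewrite neg//; have [E0 El] := E a a12; split=> //.
  have [w0 ->] := quot a a12; rewrite -E0; split=> [/eqP|->].
    by rewrite mulf_eq0 (gt_eqF w0) => /eqP.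
  by rewrite mulr0.
have /choice[r Er] : forall T, exists r : R * R, 0 < T < delta ->
    [/\ 0 < r.1, r.1 < r.2, r.2 < 1 / 12 &
      forall a, 0 < a < 1 / 12 ->
      (inflection_poly a (Ti / T) = 0 <-> a = r.1 \/ a = r.2) /\
      (inflection_poly a (Ti / T) < 0 <-> r.1 < a < r.2)].
  move=> T; case: (boolP (0 < T < delta)) => [/andP[T0 Td]|_]; last first.
    by exists (0, 0).
  have [|r Hr] := near0 T _ T0; last by exists r.
  by rewrite /= sub0r normrN gtr0_norm.
by exists delta, (fst \o r), (snd \o r); split.
Unshelve. all: by end_near. Qed.

End Branches.

(** * Asymptotics and continuity of the branches *)

Section Asymptotics.
Context {R : realType} {Ti : R}.
Hypothesis hTi : 0 < Ti.
Context {delta eps : R} {r1 r2 : R -> R}.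
Hypotheses (delta0 : 0 < delta) (eps0 : 0 < eps)
  (br : branches (Ti := Ti) delta eps r1 r2).
Local Notation d := (sqrt_temp (Ti := Ti)).

(** With [branches_lt0], this locates a point relative to the branches from the
    sign of the inflection polynomial at that point. *)
Lemma branches_gt0 a T : 0 < T < delta -> 0 < a < eps ->
  0 < inflection_poly a (Ti / T) -> a < r1 T \/ r2 T < a.
Proof.
move=> /br[_ _ _ /[apply]] [E0 El] P0.
case: (ltP a (r1 T)) => [|ra]; first by left.
case: (ltP (r2 T) a) => [|ar]; first by right.
have : ~ inflection_poly a (Ti / T) <= 0 by rewrite leNgt P0.
case; move: ra ar; rewrite le_eqVlt => /predU1P[ra _|ra].
  by rewrite E0.2//; left.
rewrite le_eqVlt => /predU1P[ar|ar]; first by rewrite E0.2//; right.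
by apply/ltW/El; rewrite ra.
Qed.

Lemma branches_lt0 a T : 0 < T < delta -> 0 < a < eps ->
  inflection_poly a (Ti / T) < 0 -> r1 T < a < r2 T.
Proof. by move=> /br[_ _ _ /[apply]] [_ El] /El. Qed.

Lemma near_range n k : 0 < k ->
  \forall T \near 0^'+, 0 < T < delta /\ 0 < k * d T ^+ n.+1 < eps.
Proof.
move=> k0; near=> T; have T0 : 0 < T by near: T; exact: nbhs_right_gt.
split; first by rewrite T0/=; near: T; exact: nbhs_right_lt.
rewrite mulr_gt0 ?exprn_gt0 ?sqrt_temp_gt0//=.
near: T; apply: (scaled_lt (Ti := Ti) (fun t => k * t ^+ n.+1)).
  by apply: continuousM; [exact: cvg_cst | exact: exprn_continuous].
by rewrite expr0n mulr0.
Unshelve. all: by end_near. Qed.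

(** The inflection polynomial is negative on a = 60 * (1 + e) * d^6, hence this
    curve lies between the branches, and positive on a = 60 * (1 - e) * d^6,
    which lies to the left of the former and hence below the lower branch. *)
Lemma lower_branch_near e : 0 < e < 1 -> \forall T \near 0^'+,
  (1 - e) * (60 * d T ^+ 6) <= r1 T <= (1 + e) * (60 * d T ^+ 6).
Proof.
move=> /andP[e0 e1].
have km : 0 < 60 * (1 - e) by lra.
have kp : 0 < 60 * (1 + e) by lra.
near=> T.
have [Td Im] : 0 < T < delta /\ 0 < 60 * (1 - e) * d T ^+ 6 < eps.
  by near: T; exact: near_range.
have [_ Ip] : 0 < T < delta /\ 0 < 60 * (1 + e) * d T ^+ 6 < eps.
  by near: T; exact: near_range.
have /(branches_lt0 _ _ Td Ip)/andP[Lp Rp] :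
    inflection_poly (60 * (1 + e) * d T ^+ 6) (Ti / T) < 0.
  by near: T; apply: lower_sign_lt0 => //; lra.
have /(branches_gt0 _ _ Td Im) Lm :
    0 < inflection_poly (60 * (1 - e) * d T ^+ 6) (Ti / T).
  by near: T; apply: lower_sign_gt0 => //; lra.
have lt_mp : 60 * (1 - e) * d T ^+ 6 < 60 * (1 + e) * d T ^+ 6.
  have T0 : 0 < T by case/andP: Td.
  by rewrite ltr_pM2r ?exprn_gt0 ?sqrt_temp_gt0//; lra.
lra.
Unshelve. all: by end_near. Qed.

Lemma upper_branch_near e : 0 < e < 1 -> \forall T \near 0^'+,
  (1 - e) * d T ^+ 3 <= r2 T <= (1 + e) * d T ^+ 3.
Proof.
move=> /andP[e0 e1].
have km : 0 < 1 - e by lra.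
have kp : 0 < 1 + e by lra.
near=> T.
have [Td Im] : 0 < T < delta /\ 0 < (1 - e) * d T ^+ 3 < eps.
  by near: T; exact: near_range.
have [_ Ip] : 0 < T < delta /\ 0 < (1 + e) * d T ^+ 3 < eps.
  by near: T; exact: near_range.
have /(branches_lt0 _ _ Td Im)/andP[Lm Rm] :
    inflection_poly ((1 - e) * d T ^+ 3) (Ti / T) < 0.
  by near: T; apply: upper_sign_lt0 => //; lra.
have /(branches_gt0 _ _ Td Ip) Lp :
    0 < inflection_poly ((1 + e) * d T ^+ 3) (Ti / T).
  by near: T; apply: upper_sign_gt0 => //; lra.
have lt_mp : (1 - e) * d T ^+ 3 < (1 + e) * d T ^+ 3.
  have T0 : 0 < T by case/andP: Td.
  by rewrite ltr_pM2r ?exprn_gt0 ?sqrt_temp_gt0//; lra.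
lra.
Unshelve. all: by end_near. Qed.

Lemma asymp_equiv_of_bounds (f g : R -> R) :
    (\forall T \near 0^'+, 0 <= g T) ->
    (forall e, 0 < e < 1 ->
      \forall T \near 0^'+, (1 - e) * g T <= f T <= (1 + e) * g T) ->
  f ~_(0^'+) g.
Proof.
move=> g0 bd; apply/eqaddoP => e e0.
have m0 : 0 < Num.min e (1 / 2) by rewrite lt_min e0 divr_gt0.
have m1 : Num.min e (1 / 2) < 1 by rewrite gt_min; apply/orP; right; lra.
near=> T; have gT : 0 <= g T by near: T.
have /andP[l r] : (1 - Num.min e (1 / 2)) * g T <= f T <=
    (1 + Num.min e (1 / 2)) * g T by near: T; apply: bd; rewrite m0.
have me : Num.min e (1 / 2) * g T <= e * g T.
  by rewrite ler_wpM2r// ge_min lexx.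
rewrite (ger0_norm gT); suff: `|f T - g T| <= e * g T by [].
by rewrite ler_norml; lra.
Unshelve. all: by end_near. Qed.

Lemma lower_branch_equiv : r1 ~_(0^'+) (fun T => 60 * (T / Ti) ^+ 3).
Proof.
have dE T : 0 < T -> (T / Ti) ^+ 3 = d T ^+ 6.
  by move=> T0; rewrite -sqrt_temp_sqr// -exprM.
apply: asymp_equiv_of_bounds => [|e e01]; near=> T.
  by rewrite mulr_ge0 ?exprn_ge0 ?divr_ge0 ?ltW.
rewrite dE; last by near: T; exact: nbhs_right_gt.
by near: T; exact: lower_branch_near.
Unshelve. all: by end_near. Qed.

Lemma upper_branch_equiv : r2 ~_(0^'+) (fun T => (T / Ti) `^ (3 / 2)).
Proof.
have dE T : 0 < T -> (T / Ti) `^ (3 / 2) = d T ^+ 3.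
  move=> T0; rewrite /sqrt_temp -powR12_sqrt ?divr_ge0 ?ltW//.
  by rewrite -powR_mulrn ?powR_ge0// -powRrM; congr (_ `^ _); field.
apply: asymp_equiv_of_bounds => [|e e01]; near=> T; first exact: powR_ge0.
rewrite dE; last by near: T; exact: nbhs_right_gt.
by near: T; exact: upper_branch_near.
Unshelve. all: by end_near. Qed.

Lemma continuous_inflection_poly (a T : R) : 0 < T ->
  {for T, continuous (fun t : R => inflection_poly a (Ti / t))}.
Proof.
move=> T0; have TN : T != 0 by rewrite gt_eqF.
apply: (continuous_comp (f := fun t : R => Ti / t) (g := inflection_poly a)).
  apply: continuousM; first exact: cvg_cst.
  by apply: continuousV => //; exact: cvg_id.
rewrite /inflection_poly /weightA /weightB /weightC.
exact: is_derive_continuous.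
Qed.

Lemma near_sign (a T : R) : 0 < T < delta ->
  (0 < inflection_poly a (Ti / T) -> \forall t \near T,
     0 < t < delta /\ 0 < inflection_poly a (Ti / t)) /\
  (inflection_poly a (Ti / T) < 0 -> \forall t \near T,
     0 < t < delta /\ inflection_poly a (Ti / t) < 0).
Proof.
move=> /andP[T0 Td]; have cT := continuous_inflection_poly a T T0.
have near_t : \forall t \near T, 0 < t < delta.
  near=> t; apply/andP; split; near: t; [exact: lt_nbhsr|exact: lt_nbhsl].
split=> P0; near=> t; split; try by near: t.
  by near: t; apply: (cvgr_gt _ cT).
by near: t; apply: (cvgr_lt _ cT).
Unshelve. all: by end_near. Qed.

(** Moving slightly off a branch, to either side, gives two points where the
    inflection polynomial has strict and opposite signs. These signs persist
    for nearby temperatures, which traps the branch between the two points. *)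
Lemma branches_continuous T : 0 < T < delta ->
  {for T, continuous r1} /\ {for T, continuous r2}.
Proof.
move=> Td; have [l0 l12 l2 E] := br T Td.
have gt0 a : 0 < a < eps -> a < r1 T \/ r2 T < a ->
    0 < inflection_poly a (Ti / T).
  move=> a0 out; have [E0 El] := E a a0.
  rewrite ltNge le_eqVlt; apply/negP => /predU1P[/E0|/El]; lra.
have lt0 a : 0 < a < eps -> r1 T < a < r2 T -> inflection_poly a (Ti / T) < 0.
  by move=> a0 ins; have [_ El] := E a a0; exact/El.
(* a step m <= e small enough to stay between 0, the branches and eps *)
have margin e : 0 < e -> exists2 m, 0 < m <= e &
    [/\ m < r1 T, m < r2 T - r1 T & m < eps - r2 T].
  move=> e0; pose q := Num.min (r1 T) (Num.min (r2 T - r1 T) (eps - r2 T)).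
  have q0 : 0 < q by rewrite !lt_min l0 !subr_gt0 l12.
  exists (Num.min e (q / 2)).
    by rewrite lt_min e0 ge_min lexx divr_gt0.
  have : Num.min e (q / 2) < q by rewrite gt_min; apply/orP; right; lra.
  by rewrite /q !lt_min => /and3P.
split; apply/cvgrPdist_le => e e0;
  have [m /andP[m0 me] [m1 m12 m2]] := margin e e0.
- have I1 : 0 < r1 T - m < eps by lra.
  have I2 : 0 < r1 T + m < eps by lra.
  near=> t.
  have [td /(branches_gt0 _ _ td I1) P1] : 0 < t < delta /\
      0 < inflection_poly (r1 T - m) (Ti / t).
    by near: t; apply: (near_sign _ _ Td).1; apply: gt0 => //; left; lra.
  have [_ /(branches_lt0 _ _ td I2) P2] : 0 < t < delta /\
      inflection_poly (r1 T + m) (Ti / t) < 0.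
    by near: t; apply: (near_sign _ _ Td).2; apply: lt0 => //; lra.
  rewrite ler_norml; lra.
- have I1 : 0 < r2 T - m < eps by lra.
  have I2 : 0 < r2 T + m < eps by lra.
  near=> t.
  have [td /(branches_lt0 _ _ td I1) P1] : 0 < t < delta /\
      inflection_poly (r2 T - m) (Ti / t) < 0.
    by near: t; apply: (near_sign _ _ Td).2; apply: lt0 => //; lra.
  have [_ /(branches_gt0 _ _ td I2) P2] : 0 < t < delta /\
      0 < inflection_poly (r2 T + m) (Ti / t).
    by near: t; apply: (near_sign _ _ Td).1; apply: gt0 => //; right; lra.
  rewrite ler_norml; lra.
Unshelve. all: by end_near. Qed.

(** This ratio and the next one measure the tangency needed for the
    singularity: the lower branch is o(T), and T^2 is o(upper branch). *)
Lemma lower_branch_over_T : r1 T / T @[T --> 0^'+] --> 0.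
Proof.
apply: (squeeze_cvgr (f := fun=> 0) (h := fun T => 90 / Ti * d T ^+ 4)).
- near=> T; have T0 : 0 < T by near: T; exact: nbhs_right_gt.
  have /andP[l r] : (1 - 1 / 2) * (60 * d T ^+ 6) <= r1 T <=
      (1 + 1 / 2) * (60 * d T ^+ 6) by near: T; apply: lower_branch_near; lra.
  have d0 := sqrt_temp_gt0 hTi T T0.
  have d6 : 0 < d T ^+ 6 by rewrite exprn_gt0.
  have TE : T = Ti * d T ^+ 2 by rewrite sqrt_temp_sqr// mulrC divfK// gt_eqF.
  apply/andP; split; first by rewrite divr_ge0//; lra.
  rewrite ler_pdivrMr//.
  rewrite (_ : 90 / Ti * d T ^+ 4 * T = 90 * d T ^+ 6); first lra.
  by rewrite [X in _ * X = _]TE; field; rewrite gt_eqF.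
- exact: cvg_cst.
- have d4 : d T ^+ 4 @[T --> 0^'+] --> (0 : R).
    have := continuous_cvg _ (@exprn_continuous R 4 0) (cvg_sqrt_temp (Ti := Ti)).
    by rewrite expr0n /=; apply.
  by have := cvgM (cvg_cst (90 / Ti)) d4; rewrite mulr0; apply.
Unshelve. all: by end_near. Qed.

Lemma T2_over_upper_branch : T ^+ 2 / r2 T @[T --> 0^'+] --> 0.
Proof.
apply: (squeeze_cvgr (f := fun=> 0) (h := fun T => 2 * Ti ^+ 2 * d T)).
- near=> T; have T0 : 0 < T by near: T; exact: nbhs_right_gt.
  have /andP[l r] : (1 - 1 / 2) * d T ^+ 3 <= r2 T <=
      (1 + 1 / 2) * d T ^+ 3 by near: T; apply: upper_branch_near; lra.
  have d0 := sqrt_temp_gt0 hTi T T0.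
  have d3 : 0 < d T ^+ 3 by rewrite exprn_gt0.
  have rp : 0 < r2 T by lra.
  have TE : T = Ti * d T ^+ 2 by rewrite sqrt_temp_sqr// mulrC divfK// gt_eqF.
  apply/andP; split; first by rewrite divr_ge0 ?exprn_ge0 ?(ltW rp) ?(ltW T0).
  rewrite ler_pdivrMr// [X in X ^+ 2 <= _]TE.
  rewrite (_ : (_ * _) ^+ 2 = 2 * Ti ^+ 2 * d T * ((1 - 1 / 2) * d T ^+ 3)).
    by rewrite ler_wpM2l// !mulr_ge0 ?exprn_ge0 ?(ltW d0) ?(ltW hTi).
  by field.
- exact: cvg_cst.
- have := cvgM (cvg_cst (2 * Ti ^+ 2)) (cvg_sqrt_temp (Ti := Ti)).
  by rewrite mulr0; apply.
Unshelve. all: by end_near. Qed.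

Lemma lower_branch_cvg0 : r1 T @[T --> 0^'+] --> 0.
Proof.
have cvgT : (T : R) @[T --> 0^'+] --> (0 : R).
  exact: (cvg_at_right_filter cvg_id).
have := cvgM lower_branch_over_T cvgT; rewrite mulr0 => /(_ _) H.
apply: cvg_trans H; apply: near_eq_cvg; near=> T.
by rewrite /= divfK// gt_eqF//; near: T; exact: nbhs_right_gt.
Unshelve. all: by end_near. Qed.

Lemma upper_branch_cvg0 : r2 T @[T --> 0^'+] --> 0.
Proof.
apply: (squeeze_cvgr (f := fun=> 0) (h := fun T => 2 * d T ^+ 3)).
- near=> T; have T0 : 0 < T by near: T; exact: nbhs_right_gt.
  have /andP[l r] : (1 - 1 / 2) * d T ^+ 3 <= r2 T <=
      (1 + 1 / 2) * d T ^+ 3 by near: T; apply: upper_branch_near; lra.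
  have d3 : 0 < d T ^+ 3 by rewrite exprn_gt0// sqrt_temp_gt0.
  lra.
- exact: cvg_cst.
- have d3 : d T ^+ 3 @[T --> 0^'+] --> (0 : R).
    have := continuous_cvg _ (@exprn_continuous R 3 0) (cvg_sqrt_temp (Ti := Ti)).
    by rewrite expr0n /=; apply.
  by have := cvgM (cvg_cst (2 : R)) d3; rewrite mulr0; apply.
Unshelve. all: by end_near. Qed.

End Asymptotics.

(** * The singularity at the origin *)

Section Singularity.
Context {R : realType}.
Implicit Types (G : {poly {poly R}}) (r : R -> R).

Lemma poly_decomp (A : nzRingType) (p : {poly A}) :
  exists (q : {poly A}) (c : A), p = q * 'X + c%:P.
Proof.
elim/poly_ind: p => [|q c _]; last by exists q, c.
by exists 0, 0; rewrite mul0r addr0.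
Qed.

Lemma eval2_decomp G (c : {poly R}) (a T : R) :
  eval2 (G * 'X + c%:P) (a, T) = eval2 G (a, T) * a + c.[T].
Proof. by rewrite /eval2 /= !hornerE. Qed.

Lemma cvg_eval2 G r : r T @[T --> 0^'+] --> 0 ->
  eval2 G (r T, T) @[T --> 0^'+] --> eval2 G (0, 0).
Proof.
move=> r0; elim/poly_ind: G => [|G c IH].
  by rewrite /eval2 /= !horner0; under eq_fun do rewrite !horner0; exact: cvg_cst.
under eq_fun do rewrite eval2_decomp; rewrite eval2_decomp.
apply: cvgD; first exact: cvgM.
apply: (continuous_cvg _ (@continuous_horner R c 0)).
exact: (cvg_at_right_filter cvg_id).
Qed.

Lemma cvg_near0 (f : R -> R) (l : R) :
  (\forall T \near 0^'+, f T = 0) -> f T @[T --> 0^'+] --> l -> l = 0.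
Proof.
move=> f0 fl; have f0' : f T @[T --> 0^'+] --> (0 : R).
  apply: cvg_near_cst; exact: f0.
exact: (cvg_unique _ fl f0').
Qed.

(** Write G(a, T) = a * G1(a, T) + T * H1(T) + c0 for a polynomial vanishing on
    the curve. Letting T tend to 0 gives c0 = 0. Along the first branch, which
    is o(T), division by T gives H1(0) = 0, which is the T-derivative. Then
    H1(T) = T * H2(T), and along the second branch, where T^2 is o(a), division
    by a gives G1(0, 0) = 0, which is the a-derivative. *)
Lemma singular_point_of_branches (S : set (R * R)) r1 r2 :
    (\forall T \near 0^'+, [/\ 0 < r1 T, 0 < r2 T, S (r1 T, T) & S (r2 T, T)]) ->
    r1 T @[T --> 0^'+] --> 0 -> r2 T @[T --> 0^'+] --> 0 ->
    r1 T / T @[T --> 0^'+] --> 0 -> T ^+ 2 / r2 T @[T --> 0^'+] --> 0 ->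
  singular_point S (0, 0).
Proof.
move=> br r10 r20 r1T r2T G GS.
have [G1 [c GE]] := poly_decomp _ G.
have [H1 [c0 cE]] := poly_decomp _ c.
have [H2 [h HE]] := poly_decomp _ H1.
have cvgT : (T : R) @[T --> 0^'+] --> (0 : R).
  exact: (cvg_at_right_filter cvg_id).
have cvgH (H : {poly R}) : H.[T] @[T --> 0^'+] --> H.[0].
  exact: (continuous_cvg _ (@continuous_horner R H 0) cvgT).
have G00 : eval2 G (0, 0) = 0.
  apply: (cvg_near0 (fun T => eval2 G (r1 T, T))); last exact: cvg_eval2.
  by near=> T; apply: GS; near: T; apply: filterS br => T [].
have c00 : c0 = 0.
  by move: G00; rewrite GE cE eval2_decomp !hornerE.
have h0 : H1.[0] = 0.
  apply: (cvg_near0 (fun T => r1 T / T * eval2 G1 (r1 T, T) + H1.[T])).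
    near=> T; have T0 : 0 < T by near: T; exact: nbhs_right_gt.
    have : eval2 G (r1 T, T) = 0.
      by apply: GS; near: T; apply: filterS br => T [].
    rewrite GE cE c00 eval2_decomp polyC0 addr0 hornerM hornerX => E.
    transitivity ((eval2 G1 (r1 T, T) * r1 T + H1.[T] * T) / T).
      by field; rewrite gt_eqF.
    by rewrite E mul0r.
  rewrite -[X in _ --> X]add0r -[X in _ --> (X + _)](mul0r (eval2 G1 (0, 0))).
  apply: cvgD (cvgH _); exact: cvgM (cvg_eval2 _ _ r10).
have hc : h = 0 by move: h0; rewrite HE !hornerE.
have G10 : eval2 G1 (0, 0) = 0.
  apply: (cvg_near0 (fun T => eval2 G1 (r2 T, T) + T ^+ 2 / r2 T * H2.[T])).
    near=> T; have rT : 0 < r2 T by near: T; apply: filterS br => T [].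
    have : eval2 G (r2 T, T) = 0.
      by apply: GS; near: T; apply: filterS br => T [].
    rewrite GE cE c00 HE hc eval2_decomp polyC0 !addr0 !hornerM !hornerX => E.
    transitivity ((eval2 G1 (r2 T, T) * r2 T + H2.[T] * T * T) / r2 T).
      by field; rewrite gt_eqF.
    by rewrite E mul0r.
  rewrite -[X in _ --> X]addr0 -[X in _ --> (_ + X)](mul0r H2.[0]).
  apply: cvgD (cvg_eval2 _ _ r20) _; exact: cvgM (cvgH _).
split=> //.
  rewrite /pderiv1 GE derivD derivM derivX derivC addr0 mulr1.
  by rewrite /eval2 /= in G10 *; rewrite !hornerE.
rewrite /pderiv2 /eval2 /= polyC0 [(map_poly _ _).[_]]horner_coef0.
rewrite coef_map_id0 ?linear0// -horner_coef0.
by rewrite GE !hornerE cE derivD derivM derivX derivC !hornerE.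
Unshelve. all: by end_near. Qed.

End Singularity.

Theorem proposition4p2 (R : realType) (a2 Ti kappa : R)
    (ha2 : 0 < a2) (hTi : 0 < Ti) (hkappa : 0 < kappa) :
  [/\ algebraic_curve_in (@state_domain R) (inflection_locus a2 Ti kappa),
      singular_point (inflection_locus a2 Ti kappa) (0, 0) &
      exists (delta eps : R) (alpha1 alpha2 : R -> R),
        [/\ 0 < delta /\ 0 < eps,
            {in `]0, delta[, continuous alpha1} /\
            {in `]0, delta[, continuous alpha2},
            (forall T, 0 < T < delta ->
               [/\ 0 < alpha1 T < eps, 0 < alpha2 T < eps &
                   alpha1 T != alpha2 T]),
            (forall alpha T, 0 < alpha < eps -> 0 < T < delta ->
               inflection_locus a2 Ti kappa (alpha, T) <->
               alpha = alpha1 T \/ alpha = alpha2 T) &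
            alpha1 ~_(0^'+) (fun T => 60 * (T / Ti) ^+ 3) /\
            alpha2 ~_(0^'+) (fun T => (T / Ti) `^ (3 / 2))]].
Proof.
have [delta [r1 [r2 [delta0 br]]]] := branches_exist hTi.
have eps0 : 0 < 1 / 12 :> R by rewrite divr_gt0.
have locus a T : 0 < a < 1 / 12 -> 0 < T < delta ->
    inflection_locus a2 Ti kappa (a, T) <-> a = r1 T \/ a = r2 T.
  move=> a12 Td; have [_ _ _ /(_ a a12)[<- _]] := br T Td.
  rewrite inflection_locusE//=; split=> [[]//|P0]; split=> //; split=> /=.
    by lra.
  by case/andP: Td.
have itv T : 0 < T < delta -> 0 < r1 T < 1 / 12 /\ 0 < r2 T < 1 / 12.
  by move=> /br[l0 l12 l2 _]; split; lra.
split; first exact: inflection_locus_algebraic.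
  apply: (singular_point_of_branches _ r1 r2).
  - near=> T; have Td : 0 < T < delta.
      by apply/andP; split; near: T; [exact: nbhs_right_gt|exact: nbhs_right_lt].
    have [I1 I2] := itv T Td; split.
    + by case/andP: I1.
    + by case/andP: I2.
    + by apply/(locus _ _ I1 Td); left.
    + by apply/(locus _ _ I2 Td); right.
  - exact: (lower_branch_cvg0 hTi delta0 eps0 br).
  - exact: (upper_branch_cvg0 hTi delta0 eps0 br).
  - exact: (lower_branch_over_T hTi delta0 eps0 br).
  - exact: (T2_over_upper_branch hTi delta0 eps0 br).
exists delta, (1 / 12), r1, r2; split=> //.
- split=> T; rewrite in_itv/= => /(branches_continuous br).
    by case.
  by case.
- move=> T Td; have [I1 I2] := itv T Td; split=> //.
  by have [_ l12 _ _] := br T Td; rewrite lt_eqF.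
- split; first exact: (lower_branch_equiv hTi delta0 eps0 br).
  exact: (upper_branch_equiv hTi delta0 eps0 br).
Unshelve. all: by end_near. Qed.
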